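(* Let $\alpha\ge\aleph_0$ be a cardinal number, $I=[0,\infty)$, and let $w$ be a weight function on $I$. Let $\varphi$ and $\varphi_n$ ($n\ge1$) be Orlicz functions such that each $\varphi_n$ satisfies the $\Delta_\varphi(0)$-condition or the $\Delta_\varphi(\infty)$-condition, and $\varphi_{n+1}\prec\varphi_n$ for every $n\in\mathbb{N}$. Then: (i) If $\alpha\le\mathfrak{c}$ or $\alpha>\mathrm{card}((\Lambda_{\varphi,w})_a)$, then $(\Lambda_{\varphi,w})_a\setminus\bigcup_{n=1}^\infty\Lambda_{\varphi_n,w}$ is not $(\alpha,\beta)$-spaceable in $(\Lambda_{\varphi,w})_a$, for any cardinal number $\beta\ge\alpha$. (ii) If $\varphi$ satisfies the $\Delta_2$-condition, then $\Lambda_{\varphi,w}\setminus\bigcup_{n=1}^\infty\Lambda_{\varphi_n,w}$ is not $(\alpha,\beta)$-spaceable in $\Lambda_{\varphi,w}$, for any cardinal number $\beta\ge\alpha$.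
   Context: The interval $I=[0,\infty)$ carries Lebesgue measure $m$. $L_0$ is the space of real Lebesgue measurable functions on $I$ modulo a.e. equality. For $f\in L_0$, $d_f(\lambda)=m(\{t\in I:|f(t)|>\lambda\})$ for $\lambda>0$, and $f^*(t)=\inf\{\lambda>0:d_f(\lambda)\le t\}$ for $t\ge 0$ (with $\inf\varnothing=\infty$). An Orlicz function is a convex function $\varphi:[0,\infty)\to[0,\infty)$ with $\varphi(0)=0=\lim_{u\to0}\varphi(u)$ and $\varphi(u)>0$ for $u>0$ (put $\varphi(\infty)=\infty$). It satisfies the $\Delta_2^\infty$-condition if there are $K>2$, $u_0\ge0$ with $\varphi(2u)\le K\varphi(u)$ for all $u\ge u_0$; the $\Delta_2^0$-condition if there are $K>2$, $u_0>0$ with $\varphi(2u)\le K\varphi(u)$ for all $0\le u\le u_0$; the $\Delta_2$-condition if it satisfies both. An Orlicz function $\psi$ satisfies the $\Delta_\varphi(\infty)$-condition (respectively, the $\Delta_\varphi(0)$-condition) if for every $b>0$ there exists $u_0>0$ such that $\varphi(u)\le\psi(bu)$ for every $u\ge u_0$ (respectively, for every $0\le u\le u_0$). Write $\varphi\prec\psi$ if there is $b>0$ with $\varphi(u)\le\psi(bu)$ for all $u\ge0$. A weight function on $I$ is a positive, decreasing (i.e. nonincreasing) function $w:(0,\infty)\to(0,\infty)$ with $\int_0^t w<\infty$ for every $t>0$ and $\int_0^\infty w=\infty$. The modular is $\rho_{\varphi,w}(f)=\int_I\varphi(f^*(t))w(t)\,dt$. The Orlicz-Lorentz space is $\Lambda_{\varphi,w}=\{f\in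 L_0:\rho_{\varphi,w}(kf)<\infty\text{ for some }k>0\}$ with the Luxemburg norm $\|f\|_{\varphi,w}=\inf\{\varepsilon>0:\rho_{\varphi,w}(f/\varepsilon)\le1\}$ (a Banach space). $(\Lambda_{\varphi,w})_a$ is its closed subspace of order-continuous elements (those $f$ with $\|f_n\|_{\varphi,w}\downarrow0$ whenever $|f_n|\le|f|$ and $|f_n|\downarrow0$ a.e.); it is well known that $(\Lambda_{\varphi,w})_a=\{f\in L_0:\rho_{\varphi,w}(kf)<\infty\text{ for every }k>0\}$. $\mathfrak{c}$ is the cardinality of the continuum. For a subset $A$ of a topological vector space $X$ and cardinals $\alpha\le\beta$: $A$ is $\alpha$-lineable if there is an $\alpha$-dimensional vector subspace $M\subset X$ with $M\subset A\cup\{0\}$; $A$ is $(\alpha,\beta)$-spaceable if $A$ is $\alpha$-lineable and for every $\alpha$-dimensional vector subspace $M_\alpha$ of $X$ with $M_\alpha\subset A\cup\{0\}$ there is a closed $\beta$-dimensional vector subspace $M_\beta$ of $X$ with $M_\alpha\subset M_\beta\subset A\cup\{0\}$. *)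

(* Defs.v *)
From HB Require Import structures.
From mathcomp Require Import all_boot all_order all_algebra.
From mathcomp Require Import all_classical all_reals all_analysis.
From mathcomp Require Import measurable_realfun.

Set Implicit Arguments.
Unset Strict Implicit.
Unset Printing Implicit Defensive.

Import Order.TTheory GRing.Theory Num.Theory.
Import numFieldNormedType.Exports.

Local Open Scope classical_set_scope.
Local Open Scope card_scope.
Local Open Scope ring_scope.

(* There is no type of cardinals in the library: a cardinal is given by a type
   [A], standing for the cardinality of [set: A]. *)
Definition card_lt T U (A : set T) (B : set U) : Prop :=
  A #<= B /\ ~ (B #<= A).

Section lineability.
Context {K : numDomainType} {V : preTopologicalLmodType K}.
Implicit Types (M B X S C : set V) (A : Type).

Definition is_subspace M : Prop := submod_closed [pred x | x \in M].

Definition lin_indep B : Prop :=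
  forall (s : seq V) (c : V -> K), uniq s -> (forall v, v \in s -> B v) ->
    \sum_(v <- s) c v *: v = 0 -> forall v, v \in s -> c v = 0.

Definition lin_span B : set V :=
  [set x | exists (s : seq V) (c : V -> K),
    (forall v, v \in s -> B v) /\ x = \sum_(v <- s) c v *: v].

Definition has_dim A M : Prop :=
  exists B, [/\ lin_indep B, lin_span B = M & B #= [set: A]].

(* In the definitions below, the topological vector space is the subset [X]
   of [V] (in all uses a linear subspace) with the topology induced by [V]. *)
Definition closed_in X M : Prop := exists2 C, closed C & M = C `&` X.

Definition lineable A X S : Prop :=
  exists M, [/\ is_subspace M, M `<=` X, has_dim A M & M `<=` S `|` [set 0]].

Definition spaceable (A B : Type) X S : Prop :=
  lineable A X S /\
  forall M, is_subspace M -> M `<=` X -> has_dim A M -> M `<=` S `|` [set 0] ->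
    exists M', [/\ is_subspace M', M' `<=` X, closed_in X M', has_dim B M'
      & M `<=` M' /\ M' `<=` S `|` [set 0]].

End lineability.

Section L0.
Context d (T : measurableType d) (R : realType).
Variable mu : {measure set T -> \bar R}.
Local Open Scope quotient_scope.

Definition L0 : Type := {mfun_ mu, T >-> R}.
HB.instance Definition _ := Choice.on L0.
HB.instance Definition _ := EqQuotient.on L0.

Definition L0_fun (f : L0) : T -> R := (repr f : {mfun T >-> R}).
Coercion L0_fun : L0 >-> Funclass.

Definition L0_pi (f : {mfun T >-> R}) : L0 := \pi_L0 f.

Definition L0_add (f g : L0) : L0 :=
  L0_pi ((repr f : {mfun T >-> R}) + (repr g : {mfun T >-> R})).
Definition L0_opp (f : L0) : L0 := L0_pi (- (repr f : {mfun T >-> R})).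
Definition L0_scale (a : R) (f : L0) : L0 :=
  L0_pi (a *: (repr f : {mfun T >-> R})).
Definition L0_zero : L0 := L0_pi 0.

Let L0_piP (f g : {mfun T >-> R}) : f = g %[ae mu] <-> L0_pi f = L0_pi g.
Proof.
split=> [fg|/eqP]; first by apply/eqP; rewrite eqmodE; exact/asboolP.
by rewrite eqmodE => /asboolP.
Qed.

Let L0_reprK (f : L0) : L0_pi (repr f) = f.
Proof. exact: reprK. Qed.

Let reprP (f : {mfun T >-> R}) : L0_fun (L0_pi f) = f %[ae mu].
Proof. by apply/L0_piP; rewrite L0_reprK. Qed.

Let piD (f g : {mfun T >-> R}) : L0_pi (f + g) = L0_add (L0_pi f) (L0_pi g).
Proof.
apply/L0_piP; have := reprP g; have := reprP f.
by apply: filterS2 => x /(_ I) fx /(_ I) gx _; exact: (esym (f_equal2 +%R fx gx)).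
Qed.

Let piN (f : {mfun T >-> R}) : L0_pi (- f) = L0_opp (L0_pi f).
Proof.
by apply/L0_piP; have := reprP f; apply: filterS => x /(_ I) fx _; exact: (esym (f_equal -%R fx)).
Qed.

Let piZ a (f : {mfun T >-> R}) : L0_pi (a *: f) = L0_scale a (L0_pi f).
Proof.
by apply/L0_piP; have := reprP f; apply: filterS => x /(_ I) fx _; exact: (esym (f_equal ( *%R a) fx)).
Qed.

Let addA : associative L0_add.
Proof.
move=> f g h; rewrite -[f]L0_reprK -[g]L0_reprK -[h]L0_reprK.
by rewrite -!piD addrA.
Qed.

Let addC : commutative L0_add.
Proof. by move=> f g; rewrite -[f]L0_reprK -[g]L0_reprK -!piD addrC. Qed.

Let add0 : left_id L0_zero L0_add.
Proof. by move=> f; rewrite -[f]L0_reprK -[LHS]piD add0r. Qed.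

Let addN : left_inverse L0_zero L0_opp L0_add.
Proof. by move=> f; rewrite -[f]L0_reprK -piN -[LHS]piD addNr. Qed.

HB.instance Definition _ := GRing.isZmodule.Build L0 addA addC add0 addN.

Let addE (f g : L0) : f + g = L0_add f g.
Proof. by []. Qed.

Let scaleA a b f : L0_scale a (L0_scale b f) = L0_scale (a * b) f.
Proof. by rewrite -[f]L0_reprK -!piZ scalerA. Qed.

Let scale1 : left_id 1 L0_scale.
Proof. by move=> f; rewrite -[f]L0_reprK -piZ scale1r. Qed.

Let scaleDr : right_distributive L0_scale +%R.
Proof.
move=> a f g; rewrite -[f]L0_reprK -[g]L0_reprK.
by rewrite [X in L0_scale a X]addE -piD -!piZ scalerDr [LHS]piD.
Qed.

Let scaleDl f : {morph L0_scale^~ f : a b / a + b}.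
Proof. by move=> a b; rewrite -[f]L0_reprK -!piZ addE -piD scalerDl. Qed.

HB.instance Definition _ :=
  GRing.Zmodule_isLmodule.Build R L0 scaleA scale1 scaleDr scaleDl.

Lemma L0_piE (f : {mfun T >-> R}) : L0_fun (L0_pi f) = f %[ae mu].
Proof. exact: reprP. Qed.

Lemma L0_eq_ae (f g : L0) : L0_fun f = g %[ae mu] <-> f = g.
Proof.
split=> [fg|->]; last exact: ae_eq_refl.
by rewrite -[f]L0_reprK -[g]L0_reprK; exact/L0_piP.
Qed.

Lemma L0D_ae (f g : L0) : L0_fun (f + g) = (fun t => f t + g t) %[ae mu].
Proof. exact: L0_piE. Qed.

Lemma L0Z_ae (a : R) (f : L0) : L0_fun (a *: f) = (fun t => a * f t) %[ae mu].
Proof. exact: L0_piE. Qed.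

Definition distrib (f : L0) (l : R) : \bar R := mu [set t | l < `|f t|].

Definition rearrangement (f : L0) (t : R) : \bar R :=
  ereal_inf [set l%:E | l in [set l | 0 < l /\ (distrib f l <= t%:E)%E]].

End L0.

Section lebesgue_halfline.
Context (R : realType).

(* The real line with the sigma-algebra of Lebesgue (Caratheodory) measurable
   sets. *)
Definition lebesgueR : Type := caratheodory_type (@wlength R idfun)^*%mu.
HB.instance Definition _ := Measurable.on lebesgueR.

Lemma measurable_halfline : measurable (`[0%R, +oo[%classic : set lebesgueR).
Proof.
apply: sub_caratheodory.
exact: (@measurable_itv R `[0%R, +oo[).
Qed.

(* Lebesgue measure on I = [0, +oo[, as the restriction to I of Lebesgue
   measure on the line: the complement of I is negligible, so [L0 lebesgueI] is
   the space of classes of measurable functions on I. *)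
Definition lebesgueI : set lebesgueR -> \bar R :=
  mrestr (@completed_lebesgue_measure R) measurable_halfline.
HB.instance Definition _ := Measure.on lebesgueI.

End lebesgue_halfline.
Arguments lebesgueI {R}.

Notation L0I R := (L0 (@lebesgueI R)).

Section orlicz_functions.
Context {R : realType}.
Implicit Types phi psi w : R -> R.

(* Functions on [0, +oo[ or ]0, +oo[ are represented by functions on R, whose
   values elsewhere are irrelevant. *)
Definition is_orlicz phi : Prop :=
  [/\ convex_function (`[0, +oo[%classic : set R) phi,
      forall u, 0 <= u -> 0 <= phi u,
      phi 0 = 0,
      phi u @[u --> 0^'+] --> (0 : R)
    & forall u, 0 < u -> 0 < phi u].

Definition Delta2_infty phi : Prop := exists K u0 : R,
  [/\ 2 < K, 0 <= u0 & forall u, u0 <= u -> phi (2 * u) <= K * phi u].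

Definition Delta2_zero phi : Prop := exists K u0 : R,
  [/\ 2 < K, 0 < u0 & forall u, 0 <= u <= u0 -> phi (2 * u) <= K * phi u].

Definition Delta2 phi : Prop := Delta2_infty phi /\ Delta2_zero phi.

(* [psi] satisfies the Delta_phi(infinity)- (resp. Delta_phi(0)-) condition. *)
Definition Delta_infty phi psi : Prop := forall b : R, 0 < b ->
  exists2 u0 : R, 0 < u0 & forall u, u0 <= u -> phi u <= psi (b * u).

Definition Delta_zero phi psi : Prop := forall b : R, 0 < b ->
  exists2 u0 : R, 0 < u0 & forall u, 0 <= u <= u0 -> phi u <= psi (b * u).

Definition orlicz_prec phi psi : Prop :=
  exists2 b : R, 0 < b & forall u, 0 <= u -> phi u <= psi (b * u).

Definition is_weight w : Prop :=
  [/\ forall t, 0 < t -> 0 < w t,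
      forall s t, 0 < s -> s <= t -> w t <= w s,
      forall t, 0 < t ->
        (\int[lebesgue_measure]_(x in `]0%R, t]) (w x)%:E < +oo)%E
    & (\int[lebesgue_measure]_(x in `]0%R, +oo[) (w x)%:E = +oo)%E].

End orlicz_functions.

Section orlicz_lorentz.
Context {R : realType} (phi w : R -> R).
Implicit Types f g : L0I R.
Local Open Scope ereal_scope.

Definition orlicz_ext (x : \bar R) : \bar R :=
  if x is r%:E then (phi r)%:E else +oo.

Definition modular f : \bar R :=
  \int[lebesgue_measure]_(t in `]0%R, +oo[)
    (orlicz_ext (rearrangement f t) * (w t)%:E).

Definition orlicz_lorentz : set (L0I R) :=
  [set f | exists2 k : R, (0 < k)%R & modular (k *: f) < +oo].

Definition luxemburg f : \bar R :=
  ereal_inf [set e%:E | e in [set e : R | (0 < e)%R /\ modular (e^-1 *: f) <= 1]].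

Definition orlicz_lorentz_a : set (L0I R) :=
  [set f | orlicz_lorentz f /\
    forall g : nat -> L0I R,
      (forall n, {ae lebesgueI, forall t, (`|g n t| <= `|f t|)%R}) ->
      {ae lebesgueI, forall t, nonincreasing_seq (fun n => `|g n t|%R) /\
                               `|g n t|%R @[n --> \oo] --> (0 : R)%R} ->
      nonincreasing_seq (fun n => luxemburg (g n)) /\
      luxemburg (g n) @[n --> \oo] --> 0].

End orlicz_lorentz.

(* [L0I R] with the topology whose open sets are those containing a ball of
   the Luxemburg norm around each of their points; it induces the norm
   topology on [orlicz_lorentz] and on its linear subspaces. *)
Definition luxemburg_space {R : realType} (phi w : R -> R) : Type := L0I R.

Section luxemburg_topology.
Context {R : realType} (phi w : R -> R).

Local Notation luxemburg_space := (luxemburg_space phi w).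

HB.instance Definition _ := GRing.Lmodule.on luxemburg_space.

Definition luxemburg_open (U : set luxemburg_space) : Prop :=
  forall f, U f -> exists2 e : R, (0 < e)%R &
    [set g : luxemburg_space | (luxemburg phi w (g - f)%R < e%:E)%E] `<=` U.

Let luxemburg_openT : luxemburg_open setT.
Proof. by move=> f _; exists 1%R. Qed.

Let luxemburg_openI : setI_closed luxemburg_open.
Proof.
move=> U V oU oV f [/oU[e e0 eU] /oV[e' e'0 eV]].
exists (Order.min e e'); first by rewrite lt_min e0.
by move=> g /=; rewrite EFin_min lt_min => /andP[/eU ? /eV ?].
Qed.

Let luxemburg_open_bigcup (I : Type) (F : I -> set luxemburg_space) :
  (forall i, luxemburg_open (F i)) -> luxemburg_open (\bigcup_i F i).
Proof.
move=> oF f [i _ /oF[e e0 eF]]; exists e => // g /eF ?.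
by exists i.
Qed.

HB.instance Definition _ := isOpenTopological.Build luxemburg_space
  luxemburg_openT luxemburg_openI luxemburg_open_bigcup.

End luxemburg_topology.

(* Main.v *)
Require Import Defs.
From HB Require Import structures.
From mathcomp Require Import all_boot all_order all_algebra.
From mathcomp Require Import all_classical all_reals all_analysis.
From mathcomp Require Import ring lra measurable_realfun.

Import Order.TTheory GRing.Theory Num.Theory.
Import numFieldNormedType.Exports.

Local Open Scope classical_set_scope.
Local Open Scope card_scope.
Local Open Scope ring_scope.

(** Write [X] for the ambient space ([(Lambda_phi,w)_a] or [Lambda_phi,w]) and
    [Y_n] for [Lambda_phi_n,w].  Spaceability fails because an infinite
    dimensional space of good vectors can be tilted towards a bad one.

    Suppose that [X \ bigcup_n Y_n] contains, up to [0], a subspace with an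
    infinite basis [B].  Truncating some nonzero vector of [B] in height and in
    support gives [g != 0] that stays in [X], because [X] is solid, and that
    belongs to every [Y_n], because a bounded function whose support has finite
    measure has a finite modular ([exists_truncation], [modular_bounded]).
    Replace each [b] in [B] by [b + d b *: g], for scalars [d b].  A nontrivial
    combination of the new vectors is [u + a *: g] with [u != 0] in the span of
    [B]; it is outside each subspace [Y_n], since [u] is and [g] is not.  So the
    tilted family is independent, has the cardinality of [B], and spans a
    subspace of [X \ bigcup_n Y_n] up to [0].  As [B] is infinite, the scalars
    [d b] can be chosen so large along [B] that the vectors
    [(d b)^-1 *: b + g] accumulate at [g].  Every closed subspace of [X] that
    contains the tilted span then contains [g], which is a nonzero vector of
    [Y_0].  This is [not_spaceable_setD_subspaces], which holds in any
    topological vector space in which the [Y_n] are subspaces and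
    neighbourhoods are governed by a sequence of absorbing sets.

    It remains to see that the spaces at hand are solid vector spaces and that
    the balls of the Luxemburg norm absorb.  The rearrangement is not
    subadditive, but [(f + g)^*(t) <= max ((2 f)^*(t/2)) ((2 g)^*(t/2))], and
    since [w] decreases, the substitution [t := 2 t] turns this into
    [rho (f + g) <= 2 rho (2 f) + 2 rho (2 g)] ([modularD]).  Together with
    [rho (s f) <= s rho f] for [0 < s <= 1] and with monotonicity, this
    inequality is all that the theory of the spaces uses: it is developed for
    an abstract functional with these properties ([lattice_modular]). *)

(** * Linear algebra: tilting an independent family *)

Section linear_algebra.
Context {K : numFieldType} {V : preTopologicalLmodType K}.
Implicit Types (M B X : set V) (s : seq V) (c : V -> K).

(** Unfolds the membership predicates hidden in [submod_closed]. *)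
Lemma is_subspaceP M : is_subspace M <->
  M 0 /\ forall (a : K) u v, M u -> M v -> M (a *: u + v).
Proof.
split=> [[M0 ML]|[M0 ML]].
  split=> [|a u v Mu Mv]; first exact: set_mem M0.
  by apply: set_mem; apply: (ML a u v); exact: mem_set.
split=> [|a u v Mu Mv]; first exact: mem_set M0.
by apply: mem_set; apply: (ML a u v); exact: set_mem.
Qed.

(** A coefficient function on a sequence with repetitions can be replaced by one
    on its distinct entries, with multiplicities absorbed in the coefficients. *)
Lemma sum_undup s c : exists c', \sum_(v <- s) c v *: v =
  \sum_(v <- undup s) c' v *: v.
Proof.
exists (fun v => c v *+ count_mem v s).
rewrite -(big_undup_iterop_count _ s); apply: eq_bigr => v _.
by rewrite Monoid.iteropE -scalerMnl; elim: (count_mem v s) => //= n ->; rewrite mulrS.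
Qed.

(** Two combinations are added after their families of vectors have been
    enlarged to a common one. *)
Lemma sum_widen s s' c : uniq s -> uniq s' -> {subset s <= s'} ->
  \sum_(v <- s) c v *: v = \sum_(v <- s') (if v \in s then c v else 0) *: v.
Proof.
move=> us us' ss'.
rewrite [RHS](eq_bigr (fun v => if v \in s then c v *: v else 0)); last first.
  by move=> v _; case: ifP => // _; rewrite scale0r.
rewrite -big_mkcond -big_filter; apply: perm_big; apply: uniq_perm => //.
  exact: filter_uniq.
by move=> v; rewrite mem_filter; case: (boolP (v \in s)) => //= /ss' ->.
Qed.

Lemma lin_span_uniq B x : lin_span B x -> exists s c,
  [/\ uniq s, forall v, v \in s -> B v & x = \sum_(v <- s) c v *: v].
Proof.
move=> [s [c [sB ->]]]; have [c' ->] := sum_undup s c.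
exists (undup s), c'; split => //; first exact: undup_uniq.
by move=> v; rewrite mem_undup => /sB.
Qed.

Lemma lin_span_subspace B : is_subspace (lin_span B).
Proof.
apply/is_subspaceP; split.
  by exists [::], (fun=> 0); split => //; rewrite big_nil.
move=> a u v /lin_span_uniq[s [c [us sB ->]]] /lin_span_uniq[s' [c' [us' s'B ->]]].
pose r := undup (s ++ s').
have ur : uniq r by exact: undup_uniq.
rewrite (@sum_widen s r)//; last by move=> x xs; rewrite mem_undup mem_cat xs.
rewrite (@sum_widen s' r)//; last by move=> x xs; rewrite mem_undup mem_cat xs orbT.
rewrite scaler_sumr -big_split/=.
exists r, (fun v => a * (if v \in s then c v else 0) + (if v \in s' then c' v else 0)).
split; last by apply: eq_bigr => x _; rewrite scalerA -scalerDl.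
by move=> x; rewrite mem_undup mem_cat => /orP[/sB|/s'B].
Qed.

Lemma sub_lin_span B : B `<=` lin_span B.
Proof.
move=> v Bv; exists [:: v], (fun=> 1); rewrite big_seq1 scale1r.
by split => // u; rewrite inE => /eqP ->.
Qed.

Lemma subspaceZ M a v : is_subspace M -> M v -> M (a *: v).
Proof.
by move=> /is_subspaceP[M0 ML] Mv; rewrite -[_ *: _]addr0; apply: ML.
Qed.

Section shift.
Variables (B : set V) (d : V -> K) (g : V).
Hypothesis Bfree : lin_indep B.
(* The line of [g] meets the span of [B] only in [0]. *)
Hypothesis gB : forall v (a : K), lin_span B v -> v = a *: g -> v = 0.

Let shift v := v + d v *: g.

Let shift_inj : {in B &, injective shift}.
Proof.
move=> u v /set_mem Bu /set_mem Bv; rewrite /shift => uv.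
have : u - v = 0.
  apply: (gB _ (d v - d u)); last first.
    have -> : (d v - d u) *: g = (v + d v *: g) - v - d u *: g.
      by rewrite scalerBl; congr (_ - _); rewrite addrC addKr.
    by rewrite -uv addrAC addrK.
  have /is_subspaceP[_ L] := lin_span_subspace B.
  by rewrite addrC -scaleN1r; apply: L; exact: sub_lin_span.
by move/eqP; rewrite subr_eq0 => /eqP.
Qed.

Lemma card_shift : (shift @` B) #= B.
Proof. by apply: inj_card_eq => u v uB vB; exact: shift_inj. Qed.

(** A combination of tilted vectors is the same combination of the original ones
    plus a multiple of [g]; the original vectors being independent, their part
    vanishes only if all the coefficients do. *)
Lemma shift_decomp s c : uniq s -> (forall v, v \in s -> (shift @` B) v) ->
  exists u (a : K), [/\ lin_span B u, \sum_(v <- s) c v *: v = u + a *: g &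
     u = 0 -> forall v, v \in s -> c v = 0].
Proof.
move=> us sB.
(* [h] undoes the tilt on the members of [s]. *)
have [h hP] : {h : V -> V | forall v, v \in s -> B (h v) /\ shift (h v) = v}.
  have /choice[h hP] v : exists u, v \in s -> B u /\ shift u = v.
    case: (boolP (v \in s)) => [/sB[u Bu uv]|_]; first by exists u.
    by exists 0.
  by exists h.
have hinj : {in s &, injective h}.
  by move=> u v us' vs huv; rewrite -(hP _ us').2 -(hP _ vs).2 huv.
have sumE : \sum_(v <- map h s) c (shift v) *: v = \sum_(v <- s) c v *: h v.
  by rewrite big_map; apply: eq_big_seq => v /hP[_ ->].
exists (\sum_(v <- s) c v *: h v), (\sum_(v <- s) c v * d (h v)); split.
- rewrite -sumE; exists (map h s), (c \o shift); split=> //.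
  by move=> _ /mapP[v /hP[? _] ->].
- rewrite scaler_suml -big_split/=; apply: eq_big_seq => v /hP[_ hv].
  by rewrite -scalerA -scalerDr; congr (_ *: _).
- rewrite -sumE => sum0 v vs; have := Bfree (map h s) (c \o shift).
  rewrite map_inj_in_uniq// => /(_ us _ sum0) H.
  have := H _ (h v); rewrite /= (hP _ vs).2; apply; last exact: map_f.
  by move=> _ /mapP[x /hP[? _] ->].
Qed.

Lemma lin_indep_shift : lin_indep (shift @` B).
Proof.
move=> s c us sB; have [u [a [Bu -> u0]]] := shift_decomp s c us sB.
move=> /eqP; rewrite addr_eq0 -scaleNr => /eqP uE; apply: u0.
exact: gB uE.
Qed.

Lemma lin_span_shift x : lin_span (shift @` B) x ->
  x = 0 \/ exists u (a : K), [/\ lin_span B u, u != 0 & x = u + a *: g].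
Proof.
move=> /lin_span_uniq[s [c [us sB xE]]].
have [u [a [Bu E u0]]] := shift_decomp s c us sB.
have [ue|une] := eqVneq u 0; last by right; exists u, a; rewrite xE.
left; rewrite xE big_seq big1// => v /(u0 ue) ->.
by rewrite scale0r.
Qed.

End shift.

(** The sets [U n] play the role of a basis of neighbourhoods of [0].  The
    obstruction is one vector [g] of [X] that lies in all the [Y n] and in the
    closure of a suitably tilted subspace avoiding them. *)
Lemma not_spaceable_setD_subspaces (A A' : Type) X (Y U : nat -> set V) :
  [set: nat] #<= [set: A] ->
  is_subspace X -> (forall n, is_subspace (Y n)) ->
  (forall (W : set V) v, open W -> W v ->
     exists n, forall u, U n u -> W (v + u)) ->
  (forall v n, X v -> exists2 t : K, t != 0 & U n (t *: v)) ->
  (forall v, X v -> v != 0 -> exists g, [/\ g != 0, X g & forall n, Y n g]) ->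
  ~ spaceable A A' X (X `\` \bigcup_n Y n).
Proof.
move=> infA subX subY nbhsU absU trunc [[M0 [subM0 M0X [B [Bfree BM0 BA]] M0Y]]].
have infB : [set: nat] #<= B by rewrite (card_le_eqr BA).
(* [N] numbers the basis, so that every index is used. *)
have [N NB] : exists N : V -> nat, [set: nat] `<=` N @` B.
  by have /pcard_geP[N] : B #>= [set: nat] := infB; exists N; exact: surj.
have BX v : B v -> X v by move=> Bv; apply/M0X; rewrite -BM0; exact: sub_lin_span.
have BY v n : lin_span B v -> v != 0 -> ~ Y n v.
  rewrite BM0 => /M0Y[[_ nY] _ Yv|->]; first by apply: nY; exists n.
  by rewrite eqxx.
have [b Bb b0] : exists2 b, B b & b != 0.
  have [b Bb _] := NB 0 I; exists b => //; apply/negP => /eqP b0.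
  have := Bfree [:: b] (fun=> 1); rewrite big_seq1 b0 scaler0 => /(_ isT).
  move=> /(_ _ erefl 0); rewrite mem_seq1 eqxx => H.
  have /eqP : (1 : K) = 0 by apply: H => // v; rewrite inE => /eqP ->; rewrite -b0.
  by rewrite oner_eq0.
have [g [g0 Xg Yg]] := trunc b (BX _ Bb) b0.
have gB v (a : K) : lin_span B v -> v = a *: g -> v = 0.
  move=> Bv vE; apply: contrapT => /eqP v0; apply: (BY v 0 Bv v0).
  by rewrite vE; apply: subspaceZ.
have /choice[t tP] v : exists t : K, t != 0 /\ (X v -> U (N v) (t *: v)).
  have [Xv|nXv] := pselect (X v); last by exists 1; rewrite oner_eq0; split.
  by have [t t0 Ut] := absU v (N v) Xv; exists t.
(* With this choice [t v *: (v + d v *: g)] is [g] plus an element of [U (N v)]. *)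
pose d v := (t v)^-1.
pose S := [set v + d v *: g | v in B].
move=> /(_ (lin_span S)).
have subS := lin_span_subspace S.
have SXY : lin_span S `<=` (X `\` \bigcup_n Y n) `|` [set 0].
  move=> x /(lin_span_shift _ _ _ Bfree)[->|[u [a [Bu u0 ->]]]]; first by right.
  have /is_subspaceP[_ XL] := subX.
  left; split.
    by rewrite addrC; apply: XL => //; apply: M0X; rewrite -BM0.
  move=> [n _ Yn]; apply: (BY u n Bu u0).
  have /is_subspaceP[_ YL] := subY n.
  by have := YL (- a) g _ (Yg n) Yn; rewrite scaleNr addrCA addNr addr0.
have SX : lin_span S `<=` X.
  by move=> x /SXY[[]//|->]; case/is_subspaceP: subX.
move=> /(_ subS SX) H.
have [|//|M' [subM' M'X [C clC M'C] _ [SM' M'XY]]] := H.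
  exists S; split => //; first exact: lin_indep_shift.
  by apply: card_eq_trans BA; exact: card_shift.
have /M'XY[[_ []]|/eqP] : M' g; last by rewrite (negbTE g0).
  2: by exists 0.
rewrite M'C; split => //; apply: contrapT => nCg.
have [n nW] := nbhsU (~` C) g (closed_openC clC) nCg.
have [v Bv Nv] := NB n I.
have [tv0 /(_ (BX _ Bv)) tvU] := tP v.
move: tvU; rewrite Nv => /nW; apply.
suff: M' (g + t v *: v) by rewrite M'C => -[].
apply: SM'; have -> : g + t v *: v = t v *: (v + d v *: g).
  by rewrite scalerDr scalerA divff// scale1r addrC.
apply: subspaceZ => //; apply: sub_lin_span; by exists v.
Qed.

End linear_algebra.

(** * Rearrangements *)

Section rearrangement.
Context {d} {T : measurableType d} {R : realType} {mu : {measure set T -> \bar R}}.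
Implicit Types (f g : L0 mu) (l : R).
Local Open Scope ereal_scope.

Lemma le_measure_ae (A B : set T) : measurable A -> measurable B ->
  {ae mu, forall t, A t -> B t} -> mu A <= mu B.
Proof.
move=> mA mB [N [mN N0 AB]].
apply: (@le_trans _ _ (mu (B `|` N))).
  apply: le_measure; rewrite ?inE//; first exact: measurableU.
  by move=> t At; have [Bt|nBt] := pselect (B t); [left|right; apply: AB => /(_ At)].
by apply: le_trans (measureU2 mu mB mN) _; rewrite -[leRHS]adde0 -N0.
Qed.

Lemma measurable_level f l : measurable [set t | (l < `|f t|)%R].
Proof.
have mf : measurable_fun setT (fun t => `|f t|)%R.
  by apply: measurableT_comp => //; exact: normr_measurable.
rewrite (_ : [set t | _] = setT `&` (fun t => `|f t|)%R @^-1` `]l, +oo[).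
  exact: mf.
by rewrite setTI; apply/seteqP; split=> t /=; rewrite in_itv/= andbT.
Qed.

Lemma le_distrib f g l : {ae mu, forall t, (`|f t| <= `|g t|)%R} ->
  distrib f l <= distrib g l.
Proof.
move=> fg; apply: le_measure_ae; [exact: measurable_level..|].
by apply: filterS fg => t fg /= /lt_le_trans; exact.
Qed.

Lemma distribZ f l (s : R) : (0 < s)%R -> distrib (s *: f) (s * l)%R <= distrib f l.
Proof.
move=> s0; apply: le_measure_ae; [exact: measurable_level..|].
apply: filterS (L0Z_ae s f) => t /(_ Logic.I) fE /=; rewrite fE.
by rewrite normrM gtr0_norm// ltr_pM2l.
Qed.

(** If [l < |f + g|] then one of [2 |f|] and [2 |g|] exceeds [l]. *)
Lemma distribD f g l :
  distrib (f + g)%R l <= distrib (2%R *: f) l + distrib (2%R *: g) l.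
Proof.
apply: (@le_trans _ _ (mu ([set t | (l < `|(2%R *: f : L0 mu) t|)%R] `|`
   [set t | (l < `|(2%R *: g : L0 mu) t|)%R]))); last first.
  by apply: measureU2; exact: measurable_level.
apply: le_measure_ae; [exact: measurable_level|by apply: measurableU; exact: measurable_level|].
have := L0D_ae f g; have := L0Z_ae 2%R f; have := L0Z_ae 2%R g.
apply: filterS3 => t /(_ Logic.I) gE /(_ Logic.I) fE /(_ Logic.I) fgE /=.
rewrite fE gE fgE !normrM (ger0_norm (ler0n _ _)) => lfg.
have := ler_normD (f t) (g t).
by have [?|?] := ltP l (2 * `|f t|)%R; [left|right; lra].
Qed.

Lemma rearrangement_ge0 f (t : R) : 0 <= rearrangement f t.
Proof. by apply: le_ereal_inf_tmp => _ [l [l0 _] <-]; rewrite lee_fin ltW. Qed.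

Lemma rearrangement_le f (t : R) l : (0 < l)%R -> distrib f l <= t%:E ->
  rearrangement f t <= l%:E.
Proof. by move=> l0 fl; apply: ereal_inf_lbound; exists l. Qed.

Lemma rearrangement_lt f (t : R) l : rearrangement f t < l%:E ->
  (0 < l)%R /\ distrib f l <= t%:E.
Proof.
move=> /ereal_inf_lt[_ [m [m0 fm] <-]]; rewrite lte_fin => ml.
split; first exact: lt_trans ml.
apply: le_trans fm; apply: le_measure; rewrite ?inE; [exact: measurable_level..|].
by move=> x /=; exact: lt_trans.
Qed.

Lemma le_rearrangement f g (t : R) : {ae mu, forall t, (`|f t| <= `|g t|)%R} ->
  rearrangement f t <= rearrangement g t.
Proof.
move=> fg; apply: ereal_inf_le_tmp => _ [l [l0 gl] <-]; exists l => //; split => //.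
exact: le_trans (le_distrib _ _ _ fg) gl.
Qed.

Lemma rearrangement_nincr f (s t : R) : (s <= t)%R ->
  rearrangement f t <= rearrangement f s.
Proof.
move=> st; apply: ereal_inf_le_tmp => _ [l [l0 fl] <-]; exists l => //; split => //.
by rewrite (le_trans fl)// lee_fin.
Qed.

Lemma rearrangementZ f (t s : R) : (0 < s)%R ->
  rearrangement (s *: f) t <= s%:E * rearrangement f t.
Proof.
move=> s0; rewrite muleC -lee_pdivrMr//.
apply: le_ereal_inf_tmp => _ [l [l0 fl] <-].
rewrite lee_pdivrMr// -EFinM; apply: rearrangement_le; first exact: mulr_gt0.
by rewrite mulrC; apply: le_trans fl; exact: distribZ.
Qed.

(** Spending half of [t] on each function bounds the measure of the set where
    [|f + g|] is large. *)
Lemma rearrangementD f g (t : R) : rearrangement (f + g)%R t <=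
  maxe (rearrangement (2%R *: f) (t / 2)%R) (rearrangement (2%R *: g) (t / 2)%R).
Proof.
set M := maxe _ _; have : 0 <= M by rewrite /M le_max rearrangement_ge0.
case ME : M => [r| |]// r0; last by rewrite leey.
(* The infima need not be attained, so levels above [M] are used. *)
apply/lee_addgt0Pr => e e0; rewrite -EFinD.
have : M < (r + e)%:E by rewrite ME lte_fin ltrDl.
rewrite gt_max => /andP[/rearrangement_lt[re0 fre] /rearrangement_lt[_ gre]].
apply: rearrangement_le => //; apply: le_trans (distribD f g _) _.
by rewrite [t in leRHS](_ : _ = t / 2 + t / 2)%R ?EFinD ?leeD//; lra.
Qed.

End rearrangement.

(** * Integrals over the half-line *)

Section halfline_integrals.
Context {R : realType}.
Local Open Scope ereal_scope.
Notation mu := (@lebesgue_measure R).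

Lemma nonincreasing_emeasurable (F : R -> \bar R) :
  (forall s t, (0 < s)%R -> (s <= t)%R -> F t <= F s) ->
  measurable_fun (`]0%R, +oo[%classic : set R) F.
Proof.
move=> ni; move=> mD; apply: (measurability _ (ErealGenCInfty.measurableE R)) => //.
move=> _ [_ [r ->] <-]; apply: is_interval_measurable => s t /=.
rewrite !in_itv/= !andbT => -[s0 rs] [t0 rt] u /andP[su ut].
rewrite !in_itv/= !andbT; split; first exact: lt_le_trans su.
by apply: le_trans rt _; apply: ni => //; exact: lt_le_trans su.
Qed.

Definition dilation (c : R) (x : measurableTypeR R) : measurableTypeR R := (x / c)%R.

Lemma measurable_dilation c : measurable_fun setT (dilation c).
Proof. exact: mulrr_measurable. Qed.

Let pushd c : {measure set (measurableTypeR R) -> \bar R} :=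
  measure_function_pushforward__canonical__measure_function_Measure
    mu (measurable_dilation c).

(** Both sides are measures in [A], so it suffices to compare them on intervals. *)
Lemma lebesgue_measure_dilation (c : R) (A : set (measurableTypeR R)) :
  (0 < c)%R -> measurable A -> pushforward mu (dilation c) A = c%:E * mu A.
Proof.
move=> c0 mA.
have k0 : (0 <= c^-1)%R by rewrite invr_ge0 ltW.
have -> : mu A = mscale (NngNum k0) (pushd c) A.
  apply: lebesgue_measure_unique => // _ [[a b] _ <-].
  rewrite -[RHS]/(c^-1%:E * mu (dilation c @^-1` `]a, b])).
  rewrite (_ : _ @^-1` _ = `](a * c)%R, (b * c)%R]%classic); last first.
    by apply/seteqP; split => x; rewrite /= !in_itv/= ltr_pdivlMr// ler_pdivrMr//.
  rewrite !lebesgue_measure_itv/= !lte_fin ltr_pM2r//.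
  case: ifPn => _; last by rewrite mule0.
  by rewrite -!EFinB -EFinM -mulrBl mulrC mulfK// gt_eqF.
by rewrite /mscale/= muleA -EFinM divff ?mul1e// gt_eqF.
Qed.

Lemma ge0_integral_dilation (c : R) (F : R -> \bar R) : (0 < c)%R ->
  measurable_fun (`]0%R, +oo[%classic : set R) F -> (forall t, (0 < t)%R -> 0 <= F t) ->
  \int[mu]_(t in `]0%R, +oo[) F (t / c)%R = c%:E * \int[mu]_(t in `]0%R, +oo[) F t.
Proof.
move=> c0 mF F0.
have c0' : (0 <= c)%R by exact: ltW.
transitivity (\int[mscale (NngNum c0') mu]_(t in `]0%R, +oo[) F t); last first.
  apply: ge0_integral_mscale => //.
  by move=> t /=; rewrite in_itv/= andbT => /F0.
transitivity (\int[pushd c]_(t in `]0%R, +oo[) F t); last first.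
  by apply: eq_measure_integral => A mA _; exact: lebesgue_measure_dilation.
have := @ge0_integral_pushforward _ _ _ _ _ _ (measurable_dilation c) mu
  `]0%R, +oo[ F (measurable_itv _) mF.
move=> ->; last by move=> t; rewrite inE/= in_itv/= andbT => /F0.
congr integral; apply/seteqP; split=> t; rewrite /= !in_itv/= !andbT /dilation.
  by move=> t0; rewrite divr_gt0.
by rewrite pmulr_lgt0// invr_gt0.
Qed.

End halfline_integrals.

(** * Orlicz functions *)

Section orlicz.
Context {R : realType} (phi : R -> R).
Hypothesis ophi : is_orlicz phi.

(** Convexity on the segment from [0] to [u], where [phi 0 = 0]. *)
Lemma orlicz_convex0 s u : 0 <= s -> s <= 1 -> 0 <= u -> phi (s * u) <= s * phi u.
Proof.
move=> s0 s1 u0; case: ophi => cvx _ phi0 _ _.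
have s01 : 0 <= s <= 1 by rewrite s0.
have := cvx (Itv01 s0 s1) u 0.
rewrite !inE/= !in_itv/= !andbT => /(_ u0 (lexx _)).
by rewrite convRE phi0 /conv/= /GRing.scale/= !mulr0 !addr0.
Qed.

Lemma orlicz_ge0 u : 0 <= u -> 0 <= phi u.
Proof. by case: ophi => _ + _ _ _; exact. Qed.

Lemma orlicz_nd u v : 0 <= u -> u <= v -> phi u <= phi v.
Proof.
move=> u0; rewrite le_eqVlt => /predU1P[->//|uv].
have v0 : 0 < v by exact: le_lt_trans uv.
have uv1 : u / v <= 1 by rewrite ler_pdivrMr// mul1r ltW.
rewrite -[u](divfK (lt0r_neq0 v0)); apply: le_trans (orlicz_convex0 _ _ _ _ _) _ => //.
- by rewrite divr_ge0// ltW.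
- exact: ltW.
- by rewrite ler_piMl// orlicz_ge0// ltW.
Qed.

Local Open Scope ereal_scope.

Lemma orlicz_ext_ge0 x : 0 <= x -> 0 <= orlicz_ext phi x.
Proof. by case: x => [r| |]//=; rewrite !lee_fin => /orlicz_ge0. Qed.

Lemma orlicz_ext_nd x y : 0 <= x -> x <= y -> orlicz_ext phi x <= orlicz_ext phi y.
Proof.
case: x => [r| |]//=; case: y => [s| |]//=; rewrite ?lee_fin ?leey//.
exact: orlicz_nd.
Qed.

Lemma orlicz_extZ (s : R) x : (0 < s)%R -> (s <= 1)%R -> 0 <= x ->
  orlicz_ext phi (s%:E * x) <= s%:E * orlicz_ext phi x.
Proof.
move=> s0 s1; case: x => [r| |]//= r0.
  by rewrite lee_fin orlicz_convex0// ltW.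
by rewrite gt0_muley ?lte_fin//= gt0_muley ?lte_fin.
Qed.

Lemma orlicz_ext_max x y : 0 <= x -> 0 <= y ->
  orlicz_ext phi (maxe x y) <= orlicz_ext phi x + orlicz_ext phi y.
Proof.
move=> x0 y0; case: (leP x y) => _; first by rewrite leeDr// orlicz_ext_ge0.
by rewrite leeDl// orlicz_ext_ge0.
Qed.

End orlicz.

(** * The modular of an Orlicz-Lorentz space *)

Section modular.
Context {R : realType} (phi w : R -> R).
Hypotheses (ophi : is_orlicz phi) (weightw : is_weight w).
Implicit Types f g : L0I R.
Local Open Scope ereal_scope.
Local Notation mu := (@lebesgue_measure R).
Local Notation rho := (modular phi w).

Let w_gt0 t : (0 < t)%R -> (0 < w t)%R.
Proof. by case: weightw => + _ _ _; exact. Qed.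

Let w_ninc s t : (0 < s)%R -> (s <= t)%R -> (w t <= w s)%R.
Proof. by case: weightw => _ + _ _; exact. Qed.

Let w_ge0 t : (0 < t)%R -> 0 <= (w t)%:E.
Proof. by move=> t0; rewrite lee_fin ltW// w_gt0. Qed.

Let measurable_w : measurable_fun (`]0%R, +oo[%classic : set R) (fun t => (w t)%:E).
Proof.
by apply: nonincreasing_emeasurable => s t s0 st; rewrite lee_fin w_ninc.
Qed.

Let in0y (t : R) : `]0%R, +oo[%classic t -> (0 < t)%R.
Proof. by rewrite /= in_itv/= andbT. Qed.

Let Phi f t := orlicz_ext phi (rearrangement f t).

Let Phi_ge0 f t : 0 <= Phi f t.
Proof. by rewrite orlicz_ext_ge0// rearrangement_ge0. Qed.

Let measurable_Phi f : measurable_fun (`]0%R, +oo[%classic : set R) (Phi f).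
Proof.
apply: nonincreasing_emeasurable => s t s0 st.
by apply: orlicz_ext_nd => //; [exact: rearrangement_ge0|exact: rearrangement_nincr].
Qed.

Let measurable_Phiw f :
  measurable_fun (`]0%R, +oo[%classic : set R) (fun t => Phi f t * (w t)%:E).
Proof. by apply: emeasurable_funM. Qed.

Let Phiw_ge0 f t : (0 < t)%R -> 0 <= Phi f t * (w t)%:E.
Proof. by move=> t0; rewrite mule_ge0// w_ge0. Qed.

Lemma modular_ge0 f : 0 <= rho f.
Proof. by apply: integral_ge0 => t /in0y; exact: Phiw_ge0. Qed.

Lemma le_modular f g : {ae lebesgueI, forall t, (`|f t| <= `|g t|)%R} ->
  rho f <= rho g.
Proof.
move=> fg; apply: ge0_le_integral => //.
- by move=> t /in0y; exact: Phiw_ge0.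
- exact: measurable_Phiw.
- exact: measurable_Phiw.
- move=> t /in0y t0; apply: lee_wpmul2r; first exact: w_ge0.
  by apply: orlicz_ext_nd => //; [exact: rearrangement_ge0|exact: le_rearrangement].
Qed.

Lemma modularZ (s : R) f : (0 < s)%R -> (s <= 1)%R -> rho (s *: f) <= s%:E * rho f.
Proof.
move=> s0 s1; rewrite -ge0_integralZl//; last 3 first.
- exact: measurable_Phiw.
- by move=> t /in0y; exact: Phiw_ge0.
- by rewrite lee_fin ltW.
apply: ge0_le_integral => //.
- by move=> t /in0y; exact: Phiw_ge0.
- exact: measurable_Phiw.
- by apply: measurable_funeM; exact: measurable_Phiw.
move=> t /in0y t0; rewrite muleA; apply: lee_wpmul2r; first exact: w_ge0.
apply: le_trans (orlicz_extZ _ _ _ _ _ _ _) => //; last exact: rearrangement_ge0.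
by apply: orlicz_ext_nd => //; [exact: rearrangement_ge0|exact: rearrangementZ].
Qed.

(** The integral of [phi ((2 f)^*(t/2)) w t] is at most that of
    [phi ((2 f)^*(t/2)) w (t/2)], because [w] decreases, and dilation by [2]
    turns the latter into [2 * rho (2 f)]. *)
Lemma modularD f g :
  rho (f + g)%R <= 2%:E * rho (2%R *: f) + 2%:E * rho (2%R *: g).
Proof.
have two0 : (0 < 2 :> R)%R by [].
have mdil h : measurable_fun (`]0%R, +oo[%classic : set R)
    (fun t => Phi h (t / 2)%R * (w (t / 2))%:E).
  apply: emeasurable_funM; apply: nonincreasing_emeasurable => s t s0 st.
    apply: orlicz_ext_nd => //; first exact: rearrangement_ge0.
    by apply: rearrangement_nincr; rewrite ler_pM2r.
  by rewrite lee_fin w_ninc ?divr_gt0// ler_pM2r.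
have dil0 h t : (0 < t)%R -> 0 <= Phi h (t / 2)%R * (w (t / 2))%:E.
  by move=> t0; apply: Phiw_ge0; rewrite divr_gt0.
have rhoE h : 2%:E * rho h =
    \int[mu]_(t in `]0%R, +oo[) (Phi h (t / 2)%R * (w (t / 2))%:E).
  by rewrite (ge0_integral_dilation _ (fun t => Phi h t * (w t)%:E))//; exact: Phiw_ge0.
rewrite [X in _ <= X + _]rhoE [X in _ <= _ + X]rhoE.
rewrite -ge0_integralD//; last 4 first.
- by move=> t /in0y; exact: dil0.
- exact: mdil.
- by move=> t /in0y; exact: dil0.
- exact: mdil.
apply: ge0_le_integral => //.
- by move=> t /in0y; exact: Phiw_ge0.
- exact: measurable_Phiw.
- by apply: emeasurable_funD; exact: mdil.
move=> t /in0y t0; rewrite -muleDl//; last by rewrite ge0_adde_def// inE.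
have t20 : (0 < t / 2)%R by rewrite divr_gt0.
apply: (@le_trans _ _ (Phi (f + g)%R t * (w (t / 2))%:E)).
  by apply: lee_wpmul2l; rewrite ?Phi_ge0// lee_fin w_ninc//; lra.
apply: lee_wpmul2r; first exact: w_ge0.
apply: le_trans (orlicz_ext_max _ _ _ _ _ _) => //; try exact: rearrangement_ge0.
by apply: orlicz_ext_nd => //; [exact: rearrangement_ge0|exact: rearrangementD].
Qed.

(** The rearrangement of [f] is at most [C] and vanishes on [[N, +oo[], and
    [w] is integrable on []0, N]]. *)
Lemma modular_bounded (C N : R) f : (0 < C)%R -> (0 < N)%R ->
  {ae lebesgueI, forall t, (`|f t| <= C)%R} -> distrib f 0 <= N%:E ->
  rho f < +oo.
Proof.
move=> C0 N0 fC fN.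
have rC (t : R) : (0 < t)%R -> rearrangement f t <= C%:E.
  move=> t0; apply: rearrangement_le => //.
  apply: (@le_trans _ _ 0); last by rewrite lee_fin ltW.
  rewrite -(measure0 (@lebesgueI R)).
  apply: le_measure_ae => //; first exact: measurable_level.
  by apply: filterS fC => x; rewrite leNgt => /negP.
have r0 (t : R) : (N <= t)%R -> rearrangement f t = 0.
  move=> Nt; apply/eqP; rewrite eq_le rearrangement_ge0 andbT.
  apply/lee_addgt0Pr => e e0; rewrite add0e; apply: rearrangement_le => //.
  apply: le_trans (le_trans fN _); last by rewrite lee_fin.
  apply: le_measure; rewrite ?inE; [exact: measurable_level..|].
  by move=> x /=; exact: lt_trans.
have phi0 : phi 0 = 0%R by case: ophi.
have [w0 _ wfin _] := weightw.
have -> : rho f = \int[mu]_(t in `]0%R, N]) (Phi f t * (w t)%:E).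
  have splitE : (`]0%R, +oo[ = `]0%R, N] `|` `]N, +oo[ :> set R)%classic.
    by rewrite -itv_bndbnd_setU// ?bnd_simp//; exact: ltW.
  rewrite /modular splitE ge0_integral_setU//; last 3 first.
  - by rewrite -splitE; exact: measurable_Phiw.
  - by move=> t; rewrite -splitE => /in0y; exact: Phiw_ge0.
  - apply/disj_setPS => t [] /=; rewrite !in_itv/= andbT => /andP[_ tN] Nt.
    by have := le_lt_trans tN Nt; rewrite ltxx.
  rewrite [X in _ + X]integral0_eq ?adde0// => t; rewrite /= in_itv/= andbT => Nt.
  by rewrite r0 ?ltW//= phi0 mul0e.
have sub0N (t : R) : (`]0%R, N]%classic t -> `]0%R, +oo[%classic t).
  by rewrite /= !in_itv/= andbT => /andP[].
apply: (@le_lt_trans _ _ ((phi C)%:E * \int[mu]_(t in `]0%R, N]) (w t)%:E)); last first.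
  apply: lte_mul_pinfty => //; last exact: wfin.
  by rewrite lee_fin; apply: orlicz_ge0 => //; exact: ltW.
rewrite -ge0_integralZl//; last 3 first.
- exact: measurable_funS measurable_w.
- by move=> t /sub0N /in0y; exact: w_ge0.
- by rewrite lee_fin; apply: orlicz_ge0 => //; exact: ltW.
apply: ge0_le_integral => //.
- by move=> t /sub0N /in0y; exact: Phiw_ge0.
- exact: measurable_funS (measurable_Phiw f).
- by apply: measurable_funeM; exact: measurable_funS measurable_w.
- move=> t /sub0N /in0y t0; apply: lee_wpmul2r; first exact: w_ge0.
  by apply: (orlicz_ext_nd _ ophi _ C%:E); [exact: rearrangement_ge0|exact: rC].
Qed.

End modular.

(** * Pointwise operations on classes of functions *)

Section multiplication.
Context {d} {T : measurableType d} {R : realType} {mu : {measure set T -> \bar R}}.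
Implicit Types (f g : L0 mu) (m : {mfun T >-> R}).

Definition L0_mul m f : L0 mu := L0_pi mu (m * (repr f : {mfun T >-> R})).

Lemma L0_mulE m f : L0_fun (L0_mul m f) = (fun t => m t * f t) %[ae mu].
Proof. exact: L0_piE. Qed.

Lemma L0_0E : {ae mu, forall t, (0 : L0 mu) t = 0}.
Proof. by have := @L0_piE _ _ _ mu 0; apply: filterS => t /(_ Logic.I). Qed.

Lemma le_norm_scale (a b : R) f : `|a| <= `|b| ->
  {ae mu, forall t, `|(a *: f : L0 mu) t| <= `|(b *: f : L0 mu) t|}.
Proof.
move=> ab; have := L0Z_ae a f; have := L0Z_ae b f.
apply: filterS2 => t /(_ Logic.I) bE /(_ Logic.I) aE.
by rewrite aE bE !normrM ler_wpM2r.
Qed.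

Lemma le_scale_norm (a : R) f g :
  {ae mu, forall t, `|f t| <= `|g t|} ->
  {ae mu, forall t, `|(a *: f : L0 mu) t| <= `|(a *: g : L0 mu) t|}.
Proof.
have := L0Z_ae a f; have := L0Z_ae a g.
apply: filterS3 => t /(_ Logic.I) bE /(_ Logic.I) aE fg.
by rewrite aE bE !normrM ler_wpM2l.
Qed.

End multiplication.

(** * The spaces defined by a modular *)

Section modular_space.
Context {d} {T : measurableType d} {R : realType} {mu : {measure set T -> \bar R}}.
Variable rho : L0 mu -> \bar R.
Implicit Types (f g : L0 mu) (m : {mfun T >-> R}).
Local Open Scope ereal_scope.

(** The properties of the modular of an Orlicz-Lorentz space that make the
    space of functions with a finite multiple a solid vector space with an
    absorbing gauge.  Subadditivity is only required up to the factor [2],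
    inside and outside: this is what rearrangements give. *)
Record lattice_modular : Prop := LatticeModular {
  lm_fin0 : rho 0%R < +oo;
  lm_ge0 : forall f, 0 <= rho f;
  lm_le : forall f g, {ae mu, forall t, (`|f t| <= `|g t|)%R} -> rho f <= rho g;
  lm_scale : forall (s : R) f, (0 < s)%R -> (s <= 1)%R ->
    rho (s *: f) <= s%:E * rho f;
  lm_add : forall f g,
    rho (f + g)%R <= 2%:E * rho (2%R *: f) + 2%:E * rho (2%R *: g) }.

(** For [rho := modular phi w] the three definitions below unfold to
    [orlicz_lorentz phi w], [luxemburg phi w] and [orlicz_lorentz_a phi w]. *)
Definition modular_space : set (L0 mu) :=
  [set f | exists2 k : R, (0 < k)%R & rho (k *: f) < +oo].

Definition modular_norm f : \bar R :=
  ereal_inf [set e%:E | e in [set e : R | (0 < e)%R /\ rho (e^-1 *: f) <= 1]].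

Definition modular_space_a : set (L0 mu) :=
  [set f | modular_space f /\
    forall g : nat -> L0 mu,
      (forall n, {ae mu, forall t, (`|g n t| <= `|f t|)%R}) ->
      {ae mu, forall t, nonincreasing_seq (fun n => `|g n t|%R) /\
                               `|g n t|%R @[n --> \oo] --> (0 : R)%R} ->
      nonincreasing_seq (fun n => modular_norm (g n)) /\
      modular_norm (g n) @[n --> \oo] --> 0].

Hypothesis lm : lattice_modular.

Lemma modular_space_solid f g : {ae mu, forall t, (`|f t| <= `|g t|)%R} ->
  modular_space g -> modular_space f.
Proof.
move=> fg [k k0 kg]; exists k => //; apply: le_lt_trans kg.
by apply: (lm_le lm); exact: le_scale_norm.
Qed.

Lemma modular_space0 : modular_space 0%R.
Proof. by exists 1%R => //; rewrite scaler0; exact: lm_fin0. Qed.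

Lemma modular_space_lin (a : R) f g :
  modular_space f -> modular_space g -> modular_space (a *: f + g)%R.
Proof.
move=> [k k0 kf] [l l0 lg].
have a0 : (0 < `|a| + 1)%R by rewrite ltr_wpDl.
pose m : R := Num.min (k / (`|a| + 1))%R l.
have m0 : (0 < m)%R by rewrite /m lt_min divr_gt0.
exists (m / 2)%R; first by rewrite divr_gt0.
rewrite scalerDr; apply: le_lt_trans (lm_add lm _ _) _.
have E h : (2%R *: ((m / 2) *: h) = m *: h :> L0 mu)%R.
  by rewrite scalerA; congr (_ *: _)%R; field.
rewrite !E scalerA; apply: lte_add_pinfty; apply: lte_mul_pinfty => //.
- apply: le_lt_trans kf; apply: (lm_le lm); apply: le_norm_scale.
  rewrite normrM (gtr0_norm m0) (gtr0_norm k0).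
  apply: (@le_trans _ _ (k / (`|a| + 1) * `|a|)%R).
    by rewrite ler_wpM2r// ge_min lexx.
  by rewrite mulrAC ler_pdivrMr// ler_pM2l// lerDl.
- apply: le_lt_trans lg; apply: (lm_le lm); apply: le_norm_scale.
  by rewrite !gtr0_norm// ge_min lexx orbT.
Qed.

Lemma modular_norm_ge0 f : 0 <= modular_norm f.
Proof. by apply: le_ereal_inf_tmp => _ [e [e0 _] <-]; rewrite lee_fin ltW. Qed.

Lemma modular_norm_le f (e : R) : (0 < e)%R -> rho (e^-1 *: f)%R <= 1 ->
  modular_norm f <= e%:E.
Proof. by move=> e0 fe; apply: ereal_inf_lbound; exists e. Qed.

(** The infimum need not be attained, but by monotonicity every level above it is
    admissible. *)
Lemma modular_norm_lt f (e : R) : modular_norm f < e%:E ->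
  (0 < e)%R /\ rho (e^-1 *: f)%R <= 1.
Proof.
move=> /ereal_inf_lt[_ [c [c0 fc] <-]]; rewrite lte_fin => ce.
have e0 : (0 < e)%R by exact: lt_trans ce.
split => //; apply: le_trans fc; apply: (lm_le lm); apply: le_norm_scale.
by rewrite !gtr0_norm ?invr_gt0// lef_pV2 ?posrE// ltW.
Qed.

Lemma le_modular_norm f g : {ae mu, forall t, (`|f t| <= `|g t|)%R} ->
  modular_norm f <= modular_norm g.
Proof.
move=> fg; apply: ereal_inf_le_tmp => _ [e [e0 ge] <-]; exists e => //; split => //.
by apply: le_trans ge; apply: (lm_le lm); exact: le_scale_norm.
Qed.

(** The triangle inequality up to a constant: with [rho (f / e) <= 1] and
    [rho (g / e) <= 1], the factor [8 = 2 * 4] leaves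
    [2 * rho (f / (4 e)) <= 2 / 4] for each of the two terms. *)
Lemma modular_normD f g (a e : R) : (0 < a)%R ->
  modular_norm f < e%:E -> modular_norm g < e%:E ->
  modular_norm (a *: (f + g))%R <= (8%R * a * e)%:E.
Proof.
move=> a0 /modular_norm_lt[e0 fe] /modular_norm_lt[_ ge].
apply: modular_norm_le; first by rewrite !mulr_gt0.
have E h : (2%R *: ((8 * a * e)^-1 *: (a *: h)) = 4^-1 *: (e^-1 *: h) :> L0 mu)%R.
  by rewrite !scalerA; congr (_ *: _)%R; field; rewrite !gt_eqF.
rewrite 2!scalerDr; apply: le_trans (lm_add lm _ _) _.
have le4 h : rho (e^-1 *: h)%R <= 1 ->
    2%:E * rho (2%R *: ((8 * a * e)^-1 *: (a *: h)))%R <= 2^-1%:E.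
  move=> he; rewrite E.
  apply: (@le_trans _ _ (2%:E * (4^-1%:E * 1))).
    apply: lee_wpmul2l => //.
    apply: le_trans (lm_scale lm _ _ _ _) _ => //; first by lra.
    by apply: lee_wpmul2l => //; rewrite lee_fin; lra.
  by rewrite mule1 -EFinM lee_fin; lra.
apply: le_trans (leeD (le4 _ fe) (le4 _ ge)) _.
by rewrite -EFinD lee_fin; lra.
Qed.

(** If [rho (k f) <= m] with [1 <= m], then [rho ((k / m) f) <= 1]. *)
Lemma modular_norm_absorbing f (e : R) : modular_space f -> (0 < e)%R ->
  exists2 t : R, (0 < t)%R & modular_norm (t *: f)%R < e%:E.
Proof.
move=> [k k0 kf] e0.
have [m m1 fm] : exists2 m : R, (1 <= m)%R & rho (k *: f)%R <= m%:E.
  move: kf; have := lm_ge0 lm (k *: f)%R.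
  case: (rho _) => [r r0 _| |]//.
  by exists (r + 1)%R; move: r0; rewrite !lee_fin; lra.
have m0 : (0 < m)%R by lra.
exists (e / 2 * (m^-1 * k))%R; first by rewrite !mulr_gt0// invr_gt0.
have e2 : (0 < e / 2)%R by lra.
apply: (@le_lt_trans _ _ (e / 2)%:E); last by rewrite lte_fin; lra.
apply: modular_norm_le => //.
rewrite -(scalerA (e / 2)%R) scalerK ?gt_eqF// -scalerA.
apply: le_trans (lm_scale lm _ _ _ _) _ => //; first by rewrite invr_gt0.
  by rewrite invf_le1.
rewrite -(mule1 m%:E) in fm.
by rewrite lee_pdivrMl.
Qed.

Lemma modular_norm_cvg0 (h : nat -> L0 mu) :
  (forall e : R, (0 < e)%R -> \forall n \near \oo, modular_norm (h n) < e%:E) ->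
  modular_norm (h n) @[n --> \oo] --> 0.
Proof.
move=> H; apply/fine_cvgP; split.
  apply: filterS (H _ ltr01) => n hn.
  by rewrite ge0_fin_numE ?modular_norm_ge0// (lt_trans hn)// ltry.
apply/cvgrPdist_lt => e e0; apply: filterS (H _ e0) => n hn /=.
have hfin : modular_norm (h n) \is a fin_num.
  by rewrite ge0_fin_numE ?modular_norm_ge0// (lt_trans hn)// ltry.
rewrite sub0r normrN ger0_norm; last by rewrite fine_ge0// modular_norm_ge0.
by rewrite -lte_fin fineK.
Qed.

Lemma modular_norm_near (h : nat -> L0 mu) (e : R) : (0 < e)%R ->
  modular_norm (h n) @[n --> \oo] --> 0 -> \forall n \near \oo, modular_norm (h n) < e%:E.
Proof.
move=> e0 h0; have := nbhs_open_ereal_lt (f := fun=> e) e0.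
by move/h0.
Qed.

Lemma modular_space_a_solid f g : {ae mu, forall t, (`|f t| <= `|g t|)%R} ->
  modular_space_a g -> modular_space_a f.
Proof.
move=> fg [mg ocg]; split; first exact: modular_space_solid mg.
move=> h hf h0; apply: ocg => // n.
by have := hf n; apply: filterS2 fg => t; exact: (fun x y => le_trans y x).
Qed.

Lemma modular_norm_nincr (h : nat -> L0 mu) :
  {ae mu, forall t, nonincreasing_seq (fun n => `|h n t|%R) /\
                               `|h n t|%R @[n --> \oo] --> (0 : R)%R} ->
  nonincreasing_seq (fun n => modular_norm (h n)).
Proof.
move=> h0 m n mn; apply: le_modular_norm.
by apply: filterS h0 => t [ni _]; exact: ni.
Qed.

Lemma modular_space_a0 : modular_space_a 0%R.
Proof.
split; first exact: modular_space0.
move=> h hf h0; split; first exact: modular_norm_nincr.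
apply: modular_norm_cvg0 => e e0; near=> n.
have [t t0 te] := modular_norm_absorbing _ _ modular_space0 e0.
by rewrite scaler0 in te; apply: le_lt_trans te; exact: le_modular_norm.
Unshelve. all: by end_near. Qed.

(** This is how order continuity of one summand is used for a sequence that is
    dominated by that summand on a part of the space only: [m] localizes [h] to
    that part. *)
Lemma modular_space_a_mul f m (h : nat -> L0 mu) : modular_space_a f ->
  {ae mu, forall t, nonincreasing_seq (fun n => `|h n t|%R) /\
                               `|h n t|%R @[n --> \oo] --> (0 : R)%R} ->
  (forall n, {ae mu, forall t, (`|m t * h n t| <= `|f t|)%R}) ->
  modular_norm (L0_mul m (h n)) @[n --> \oo] --> 0.
Proof.
move=> [_ ocf] h0 mhf.
have mhE : {ae mu, forall t, forall n, L0_mul m (h n) t = (m t * h n t)%R}.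
  apply/ae_foralln => n.
  by have := L0_mulE m (h n); apply: filterS => t /(_ Logic.I).
have [||//] := ocf (fun n => L0_mul m (h n)).
  by move=> n; have := mhf n; apply: filterS2 mhE => t ->.
apply: filterS2 mhE h0 => t mhE [nih h0]; split.
  by move=> i j ij; rewrite !mhE !normrM ler_wpM2l// nih.
under eq_fun do rewrite mhE normrM.
by rewrite -(mulr0 `|m t|%R); exact: cvgMr.
Qed.

(** If [|h_n| <= |a f + g|] then [|h_n| <= (|a| + 1) max (|f|, |g|)].  So [h_n],
    divided by [|a| + 1] and cut along the set where [|g| <= |f|], splits into
    one part dominated by [f] and one dominated by [g]. *)
Lemma modular_space_a_lin (a : R) f g :
  modular_space_a f -> modular_space_a g -> modular_space_a (a *: f + g)%R.
Proof.
move=> af ag; split; first by apply: modular_space_lin; [case: af|case: ag].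
move=> h hfg h0; split; first exact: modular_norm_nincr.
have c0 : (0 < `|a| + 1)%R by rewrite ltr_wpDl.
set c : R := (`|a| + 1)%R in c0.
pose F := [set t | (`|g t| <= `|f t|)%R].
have mF : measurable F.
  have mn k : measurable_fun setT (fun t => `|(k : L0 mu) t|)%R.
    by apply: measurableT_comp => //; exact: normr_measurable.
  have mtrue : measurable [set true] by [].
  have := measurable_fun_ler (mn g) (mn f) measurableT mtrue.
  by rewrite setTI; congr measurable; apply/seteqP; split.
pose m1 : {mfun T >-> R} := (c^-1 *: (mindic R mF : {mfun T >-> R}))%R.
pose m2 : {mfun T >-> R} := (c^-1 *: (mindic R (measurableC mF) : {mfun T >-> R}))%R.
have m1E t : m1 t = (c^-1 * \1_F t)%R by [].
have m2E t : m2 t = (c^-1 * \1_(~` F) t)%R by [].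
have m12 t : (m1 t + m2 t = c^-1)%R.
  rewrite m1E m2E !indicE in_setC.
  by case: (t \in F); rewrite /= ?mulr1 ?mulr0 ?addr0 ?add0r.
have hE n : h n = (c *: (L0_mul m1 (h n) + L0_mul m2 (h n)) :> L0 mu)%R.
  apply/L0_eq_ae.
  pose k1 := L0_mul m1 (h n); pose k2 := L0_mul m2 (h n).
  have kE : {ae mu, forall t, ((k1 + k2 : L0 mu) t = c^-1 * h n t)%R}.
    have := L0D_ae k1 k2; have := L0_mulE m1 (h n); have := L0_mulE m2 (h n).
    apply: filterS3 => t /(_ Logic.I) k2E /(_ Logic.I) k1E /(_ Logic.I) ->.
    by rewrite k1E k2E -mulrDl m12.
  have := L0Z_ae c (k1 + k2)%R; apply: filterS2 kE => t kE /(_ Logic.I) E _.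
  by rewrite E kE mulVKf// gt_eqF.
have lec t : (`|(a * f t + g t)%R| <= c * Num.max `|f t| `|g t|)%R.
  rewrite (le_trans (ler_normD _ _))// normrM /c mulrDl mul1r lerD//.
    by rewrite ler_wpM2l// le_max lexx.
  by rewrite le_max lexx orbT.
have hle n : {ae mu, forall t, (c^-1 * `|h n t| <= Num.max `|f t| `|g t|)%R}.
  have := hfg n; have := L0D_ae (a *: f)%R g; have := L0Z_ae a f.
  apply: filterS3 => t /(_ Logic.I) afE /(_ Logic.I) E hn.
  by rewrite ler_pdivrMl//; apply: le_trans hn _; rewrite E afE; exact: lec.
have cvg1 : modular_norm (L0_mul m1 (h n)) @[n --> \oo] --> 0.
  apply: (@modular_space_a_mul f) => // n; apply: filterS (hle n) => t.
  rewrite m1E normrM indicE; have [/set_mem tF|_] := boolP (t \in F).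
    by rewrite mulr1 gtr0_norm ?invr_gt0// max_l.
  by rewrite mulr0 normr0 mul0r.
have cvg2 : modular_norm (L0_mul m2 (h n)) @[n --> \oo] --> 0.
  apply: (@modular_space_a_mul g) => // n; apply: filterS (hle n) => t.
  rewrite m2E normrM indicE in_setC; have [_|tF] := boolP (t \in F).
    by rewrite mulr0 normr0 mul0r.
  rewrite mulr1 gtr0_norm ?invr_gt0// max_r//.
  by case: (leP `|g t|%R `|f t|%R) tF => [gf /negP[]|/ltW//]; exact: mem_set.
apply: modular_norm_cvg0 => e e0.
(* The two parts being of norm less than [e'], the sum has norm at most
   [8 * c * e' = e / 2]. *)
pose e' := (e / (16 * c))%R.
have e'0 : (0 < e')%R by rewrite divr_gt0// mulr_gt0.
have := modular_norm_near _ _ e'0 cvg1; have := modular_norm_near _ _ e'0 cvg2.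
apply: filterS2 => n n2 n1; rewrite hE.
apply: le_lt_trans (modular_normD _ _ _ _ c0 n1 n2) _.
by rewrite lte_fin /e'; rewrite (_ : _ * _ = e / 2)%R ?ltr_pdivrMr//; [lra|field; rewrite gt_eqF].
Qed.

End modular_space.

(** * Application to Orlicz-Lorentz spaces *)

Lemma modular_lattice_modular {R : realType} (phi w : R -> R) :
  is_orlicz phi -> is_weight w -> lattice_modular (modular phi w).
Proof.
move=> ophi weightw; split.
- apply: (modular_bounded _ _ ophi weightw 1 1) => //.
    by apply: filterS L0_0E => t ->; rewrite normr0.
  rewrite (@le_trans _ _ 0%E) ?lee_fin// -(measure0 (@lebesgueI R)).
  apply: le_measure_ae => //; first exact: measurable_level.
  by apply: filterS L0_0E => t /= ->; rewrite normr0 ltxx.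
- exact: modular_ge0.
- exact: le_modular.
- exact: modularZ.
- exact: modularD.
Qed.

Section truncation.
Context {R : realType}.
Implicit Types f : L0I R.

Lemma measurable_window (N : R) : measurable (`[- N, N]%classic : set (lebesgueR R)).
Proof. by apply: sub_caratheodory; exact: (@measurable_itv R `[- N, N]). Qed.

Lemma lebesgueI_window (N : R) : 0 <= N ->
  (@lebesgueI R `[(- N)%R, N]%classic <= (2 * N)%:E)%E.
Proof.
move=> N0.
apply: (@le_trans _ _ (@completed_lebesgue_measure R `[- N, N]%classic)).
  apply: le_measure; rewrite ?inE; [|exact: measurable_window|exact: subIsetl].
  by apply: measurableI; [exact: measurable_window|exact: measurable_halfline].
rewrite -[leLHS]/(@lebesgue_measure R `[- N, N]%classic) lebesgue_measure_itv/= lte_fin.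
case: ifPn => _; rewrite ?lee_fin; lra.
Qed.

(** The truncations of [f] to [[-n, n]], at the points where [|f| <= n], are
    bounded with support of finite measure.  They are not all zero, as every point
    is eventually caught. *)
Lemma exists_truncation f : f != 0 -> exists2 g : L0I R, g != 0 &
  {ae lebesgueI, forall t, `|g t| <= `|f t|} /\
  exists C N : R, [/\ 0 < C, 0 < N, {ae lebesgueI, forall t, `|g t| <= C}
    & (distrib g 0 <= N%:E)%E].
Proof.
move=> f0.
pose F (n : nat) : set (lebesgueR R) :=
  `[- n.+1%:R, n.+1%:R]%classic `&` ~` [set t | n.+1%:R < `|f t|].
have mF n : measurable (F n).
  apply: measurableI; first exact: measurable_window.
  by apply: measurableC; exact: measurable_level.
pose g n : L0I R := L0_mul (mindic R (mF n)) f.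
have gE n : {ae lebesgueI, forall t, g n t = \1_(F n) t * f t}.
  by have := L0_mulE (mu := lebesgueI) (mindic R (mF n)) f; apply: filterS => t /(_ Logic.I).
have [n gn0] : exists n, g n != 0.
  apply: contrapT => /forallNP g0; move/eqP: f0; apply.
  apply/L0_eq_ae.
  have : {ae lebesgueI, forall t, forall n, \1_(F n) t * f t = 0}.
    apply/ae_foralln => n; have /negP := g0 n; rewrite negbK => /eqP gn.
    by have := gE n; rewrite gn; apply: filterS2 L0_0E => t ->.
  apply: filterS2 L0_0E => t -> fF _.
  (* This window catches [t]: its size exceeds both [|t|] and [|f t|]. *)
  have := fF (Num.trunc (Num.max `|t| `|f t|)).
  rewrite indicE mem_set ?mul1r//.
  have := truncnS_gt (Num.max `|t| `|f t|).
  rewrite gt_max => /andP[tn fn]; split.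
    by rewrite /= in_itv/= -ler_norml ltW.
  by move=> /=; rewrite ltNge ltW.
exists (g n) => //; split.
  apply: filterS (gE n) => t ->; rewrite normrM indicE.
  by case: (t \in F n); rewrite ?normr1 ?mul1r// normr0 mul0r.
exists n.+1%:R, (2 * n.+1%:R); split => //.
- apply: filterS (gE n) => t ->; rewrite normrM indicE.
  have [/set_mem[_ /= tF]|_] := boolP (t \in F n); last by rewrite normr0 mul0r.
  by rewrite normr1 mul1r leNgt; apply/negP.
- apply: le_trans (lebesgueI_window n.+1%:R _) => //.
  apply: le_measure_ae; [exact: measurable_level|exact: measurable_window|].
  apply: filterS (gE n) => t /= ->; rewrite indicE.
  have [/set_mem[]//|_] := boolP (t \in F n).
  by rewrite mul0r normr0 ltxx.
Qed.

End truncation.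

(** Solidity of [X] keeps in [X] the truncations of its members, and these lie in
    every Orlicz-Lorentz space with weight [w]. *)
Lemma not_spaceable_setD_orlicz_lorentz {R : realType} (A B : Type) (w phi : R -> R)
    (phi_ : nat -> R -> R) (X : set (L0I R)) :
  [set: nat] #<= [set: A] -> is_weight w -> is_orlicz phi ->
  (forall n, is_orlicz (phi_ n)) ->
  is_subspace (V := luxemburg_space phi w) X ->
  X `<=` orlicz_lorentz phi w ->
  (forall f g : L0I R, {ae lebesgueI, forall t, `|f t| <= `|g t|} -> X g -> X f) ->
  ~ spaceable (V := luxemburg_space phi w) A B X
      (X `\` \bigcup_n orlicz_lorentz (phi_ n) w).
Proof.
move=> infA weightw ophi ophi_ subX XL solidX.
have lm := modular_lattice_modular _ _ ophi weightw.
pose U (n : nat) : set (luxemburg_space phi w) :=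
  [set f | (luxemburg phi w f < n.+1%:R^-1%:E)%E].
apply: (not_spaceable_setD_subspaces _ _ _ _ U) => //.
- move=> n; have lmn := modular_lattice_modular _ _ (ophi_ n) weightw.
  apply/is_subspaceP; split; first exact: (modular_space0 _ lmn).
  exact: (modular_space_lin _ lmn).
- move=> W v oW /oW[e e0 eW].
  have := near_infty_natSinv_lt (PosNum e0); case=> n _ /(_ _ (leqnn n)) /= ne.
  exists n => u Uu; apply: eW => /=; rewrite addrC addKr.
  by apply: lt_trans Uu _; rewrite lte_fin.
- move=> v n Xv.
  have [t t0 tv] := modular_norm_absorbing _ lm v n.+1%:R^-1 (XL _ Xv) ltac:(by []).
  by exists t; [rewrite gt_eqF|].
- move=> v Xv v0; have [g g0 [gv [C [N [C0 N0 gC gN]]]]] := exists_truncation v v0.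
  exists g; split => //; first exact: solidX Xv.
  move=> n; exists 1 => //; rewrite scale1r.
  exact: (modular_bounded _ _ (ophi_ n) weightw C N).
Qed.

Theorem corollary4p7 (R : realType) (A : Type) (w phi : R -> R)
    (phi_ : nat -> R -> R)
    (infA : [set: nat] #<= [set: A])
    (weight_w : is_weight w)
    (orlicz_phi : is_orlicz phi)
    (orlicz_phi_ : forall n, is_orlicz (phi_ n))
    (Delta_phi_ : forall n, Delta_zero phi (phi_ n) \/ Delta_infty phi (phi_ n))
    (prec_phi_ : forall n, orlicz_prec (phi_ n.+1) (phi_ n)) :
  ([set: A] #<= [set: R] \/ card_lt (orlicz_lorentz_a phi w) [set: A] ->
    forall B : Type, [set: A] #<= [set: B] ->
      ~ spaceable (V := luxemburg_space phi w) A B (orlicz_lorentz_a phi w)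
          (orlicz_lorentz_a phi w `\` \bigcup_n orlicz_lorentz (phi_ n) w))
  /\
  (Delta2 phi ->
    forall B : Type, [set: A] #<= [set: B] ->
      ~ spaceable (V := luxemburg_space phi w) A B (orlicz_lorentz phi w)
          (orlicz_lorentz phi w `\` \bigcup_n orlicz_lorentz (phi_ n) w)).
Proof.
have lm := modular_lattice_modular _ _ orlicz_phi weight_w.
split=> _ B _.
- apply: (not_spaceable_setD_orlicz_lorentz _ _ _ _ _ _ infA weight_w orlicz_phi orlicz_phi_).
  + apply/is_subspaceP; split; first exact: (modular_space_a0 _ lm).
    exact: (modular_space_a_lin _ lm).
  + by move=> f [].
  + exact: (modular_space_a_solid _ lm).
- apply: (not_spaceable_setD_orlicz_lorentz _ _ _ _ _ _ infA weight_w orlicz_phi orlicz_phi_).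
  + apply/is_subspaceP; split; first exact: (modular_space0 _ lm).
    exact: (modular_space_lin _ lm).
  + exact: subset_refl.
  + exact: (modular_space_solid _ lm).
Qed.
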